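(* Let $(\mu_N)_{N\ge1}$ be a sequence of absolutely continuous probability measures on $\mathbf{R}^d$ whose densities belong to $L^\infty(\mathbf{R}^d)$ and satisfy $\sup_N\|d\mu_N\|_{L^\infty}\le M$ for some $M<\infty$, where $d\mu_N$ denotes the density of $\mu_N$. For each $N$ let $x_1^N,\dots,x_N^N\in\mathbf{R}^d$ and let $$\nu_N=\frac1N\sum_{i=1}^N\delta_{x_i^N}.$$ Then there exists $k>0$ such that, for all $N$, $$\|\nu_N-\mu_N\|_{BL}\ge\frac{k}{N^{1/d}}.$$
   Context: The bounded Lipschitz norm of a (signed) measure $\mu$ on $\mathbf{R}^d$ is $\|\mu\|_{BL}=\sup_{f\in W^{1,\infty}(\mathbf{R}^d),\,f\ne0}\frac{\int f\,d\mu}{\|f\|_{W^{1,\infty}}}$, where $\|f\|_{W^{1,\infty}}=\max\{\|f\|_{L^\infty},\|\nabla f\|_{L^\infty}\}$. *)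

(* Defs.v *)
From HB Require Import structures.
From mathcomp Require Import all_boot all_order all_algebra.
From mathcomp Require Import all_classical all_reals all_analysis.
Set Implicit Arguments.
Unset Strict Implicit.
Unset Printing Implicit Defensive.
Import Order.TTheory GRing.Theory Num.Theory.
Import numFieldNormedType.Exports.
Local Open Scope classical_set_scope.
Local Open Scope ring_scope.

Definition measure_rV_display : measure_display.
Proof. exact: default_measure_display. Qed.

Section measurable_rV.
Context {R : realType} (n : nat).

Definition coord_rV (i : 'I_n) (x : 'rV[R]_n) : measurableTypeR R := x 0 i.

Let rV_set0 : g_sigma_preimage coord_rV set0.
Proof. exact: sigma_algebra0. Qed.

Let rV_setC A : g_sigma_preimage coord_rV A -> g_sigma_preimage coord_rV (~` A).
Proof. exact: sigma_algebraC. Qed.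

Let rV_bigcup (F : _^nat) : (forall i, g_sigma_preimage coord_rV (F i)) ->
  g_sigma_preimage coord_rV (\bigcup_i (F i)).
Proof. exact: sigma_algebra_bigcup. Qed.

(* As R is second countable, this product sigma-algebra is the Borel
   sigma-algebra of 'rV[R]_n. *)
HB.instance Definition _ := @isMeasurable.Build measure_rV_display
  'rV[R]_n (g_sigma_preimage coord_rV) rV_set0 rV_setC rV_bigcup.

Lemma measurable_coord_rV i : measurable_fun [set: 'rV[R]_n] (coord_rV i).
Proof.
move=> _ Y mY; rewrite setTI; apply: sub_sigma_algebra => /=.
rewrite -bigcup_seq/=; exists i => /=; first by rewrite mem_index_enum.
by exists Y => //; rewrite setTI.
Qed.

Lemma measurable_fun_rV d (T : measurableType d) (f : T -> 'rV[R]_n) :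
  (forall i, measurable_fun [set: T] (coord_rV i \o f)) ->
  measurable_fun [set: T] f.
Proof.
move=> mf _ A mA; rewrite setTI.
have mfC (B : set 'rV[R]_n) : (\big[setU/set0]_(i < n)
    preimage_set_system setT (coord_rV i) measurable) B -> measurable (f @^-1` B).
  rewrite -bigcup_seq => -[i _ [Y mY <-]].
  by rewrite setTI -comp_preimage -[X in measurable X]setTI; exact: mf.
apply: (mA [set B | measurable (f @^-1` B)]); split => //=.
by split => /= [|B mB|F mF]; [rewrite preimage_set0|
  rewrite setTD preimage_setC; exact: measurableC|
  rewrite preimage_bigcup; exact: bigcup_measurable].
Qed.
End measurable_rV.

Section cons_rV.
Context {R : realType} (n : nat).

Definition cons_rV (p : measurableTypeR R * 'rV[R]_n) : 'rV[R]_n.+1 :=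
  \row_i (if unlift ord0 i is Some j then p.2 0 j else p.1).

Definition uncons_rV (x : 'rV[R]_n.+1) : measurableTypeR R * 'rV[R]_n :=
  (x 0 ord0, \row_j x 0 (lift ord0 j)).

Lemma cons_rVK : cancel cons_rV uncons_rV.
Proof.
move=> [a y]; rewrite /uncons_rV /cons_rV mxE unlift_none; congr pair.
by apply/rowP => j; rewrite !mxE liftK.
Qed.

Lemma measurable_cons_rV : measurable_fun setT cons_rV.
Proof.
apply: measurable_fun_rV => i.
case: (unliftP ord0 i) => [j|] ->{i}.
  rewrite (_ : _ \o _ = coord_rV j \o snd).
    by apply: measurableT_comp => //; exact: measurable_coord_rV.
  by apply/funext => p; rewrite /= /coord_rV mxE liftK.
rewrite (_ : _ \o _ = fst) //.
by apply/funext => p; rewrite /= /coord_rV mxE unlift_none.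
Qed.

Lemma measurable_uncons_rV : measurable_fun setT uncons_rV.
Proof.
apply/measurable_fun_pairP; split.
  exact: (measurable_coord_rV (ord0 : 'I_n.+1)).
apply: measurable_fun_rV => j.
rewrite (_ : _ \o _ = coord_rV (lift ord0 j)); first exact: measurable_coord_rV.
by apply/funext => x; rewrite /= /coord_rV mxE.
Qed.

HB.instance Definition _ := isMeasurableFun.Build _ _ _ _ cons_rV
  measurable_cons_rV.

Variable mu : {sigma_finite_measure set 'rV[R]_n -> \bar R}.

Definition lebesgue_cons : set 'rV[R]_n.+1 -> \bar R :=
  pushforward (lebesgue_measure \x mu)%E cons_rV.

Let lebesgue_cons0 : lebesgue_cons set0 = 0%E.
Proof. exact: measure0. Qed.

Let lebesgue_cons_ge0 A : (0 <= lebesgue_cons A)%E.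
Proof. exact: measure_ge0. Qed.

Let lebesgue_cons_sigma_additive : semi_sigma_additive lebesgue_cons.
Proof. exact: measure_semi_sigma_additive. Qed.

HB.instance Definition _ := isMeasure.Build _ _ _ lebesgue_cons
  lebesgue_cons0 lebesgue_cons_ge0 lebesgue_cons_sigma_additive.

Let lebesgue_cons_sigma_finite : sigma_finite setT lebesgue_cons.
Proof.
have /sigma_finiteP[F [TF ndF Foo]] := sigma_finiteT (@lebesgue_measure R).
have /sigma_finiteP[G [TG ndG Goo]] := sigma_finiteT mu.
exists (fun k => uncons_rV @^-1` (F k `*` G k)).
  rewrite -preimage_bigcup (_ : \bigcup_k _ = setT) ?preimage_setT//.
  rewrite -subTset => -[a y] _.
  have [k _ Fka] : (\bigcup_k F k) a by rewrite -TF.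
  have [l _ Gly] : (\bigcup_k G k) y by rewrite -TG.
  exists (maxn k l) => //; split => /=.
    by move: a Fka; exact/subsetPset/ndF/leq_maxl.
  by move: y Gly; exact/subsetPset/ndG/leq_maxr.
move=> k; have [mF Fk] := Foo k; have [mG Gk] := Goo k; split.
  by rewrite -[X in measurable X]setTI; apply: measurable_uncons_rV => //;
    exact: measurableX.
rewrite /lebesgue_cons /pushforward -comp_preimage.
rewrite (_ : _ \o _ = id); last by apply/funext; exact: cons_rVK.
by rewrite preimage_id product_measure1E// lte_mul_pinfty// ge0_fin_numE.
Qed.

HB.instance Definition _ := Measure_isSigmaFinite.Build _ _ _ lebesgue_cons
  lebesgue_cons_sigma_finite.

End cons_rV.

Fixpoint lebesgue_rV {R : realType} (n : nat) :
    {sigma_finite_measure set 'rV[R]_n -> \bar R} :=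
  if n is n'.+1 then lebesgue_cons (lebesgue_rV n') else \d_(0 : 'rV[R]_0).

Lemma lebesgue_rV_box {R : realType} n (a b : 'rV[R]_n) :
  (forall i, a 0 i <= b 0 i) ->
  lebesgue_rV n [set x | forall i, x 0 i \in `[a 0 i, b 0 i]] =
  (\prod_(i < n) (b 0 i - a 0 i))%:E.
Proof.
elim: n a b => [|n IHn] a b ab.
  by rewrite big_ord0 /= diracE mem_set// => -[].
rewrite /= /lebesgue_cons /pushforward big_ord_recl EFinM.
pose a' := \row_j a 0 (lift ord0 j); pose b' := \row_j b 0 (lift ord0 j).
pose B := [set x : 'rV[R]_n | forall i, x 0 i \in `[a' 0 i, b' 0 i]].
have mB : measurable B.
  rewrite (_ : B = \bigcap_(i in [set: 'I_n])
      (coord_rV i @^-1` `[a' 0 i, b' 0 i])).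
    apply: fin_bigcap_measurable => // i _.
    by rewrite -[X in measurable X]setTI; exact: measurable_coord_rV.
  by apply/seteqP; split=> x /= Bx i => [_|]; exact: Bx.
rewrite (_ : _ @^-1` _ = `[a 0 ord0, b 0 ord0]%classic `*` B); last first.
  apply/seteqP; split => -[t y] /= => [tyB|[tab yB] i].
    split; first by have := tyB ord0; rewrite mxE unlift_none.
    by move=> j; have := tyB (lift ord0 j); rewrite !mxE liftK.
  rewrite mxE; case: (unliftP ord0 i) => [j|] ->//.
  by have := yB j; rewrite !mxE.
rewrite product_measure1E//= lebesgue_measure_itv/= IHn; last first.
  by move=> j; rewrite !mxE.
congr mule; last by congr EFin; apply: eq_bigr => j _; rewrite !mxE.
rewrite lte_fin; case: ltgtP (ab ord0) => // ->; by rewrite subrr.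
Qed.

Section test_functions.
Context {R : realType} (n : nat).
Implicit Types (phi : 'rV[R]_n -> R) (s : seq 'I_n).

Definition partial (i : 'I_n) phi : 'rV[R]_n -> R := 'D_(delta_mx 0 i) phi.

Definition iter_partial s phi := foldr partial phi s.

Definition smooth phi := forall s, continuous (iter_partial s phi) /\
  forall i x, derivable (iter_partial s phi) x (delta_mx 0 i).

Definition test_function phi :=
  smooth phi /\ compact (closure [set x | phi x != 0]).

End test_functions.

Section sobolev.
Context {R : realType} (n : nat).
Local Notation lambda := (@lebesgue_rV R n).
Implicit Types (f : 'rV[R]_n -> R) (g : 'rV[R]_n -> 'rV[R]_n).

(* The norm of the library on 'rV[R]_n is the sup norm, not the Euclidean
   one. *)
Definition norm2 (v : 'rV[R]_n) : R := Num.sqrt (\sum_i v 0 i ^+ 2).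

Definition Loo_norm f : \bar R := 'N[lambda]_+oo[EFin \o f]%E.

Definition Loo_weak_gradient f g := [/\ measurable_fun [set: 'rV[R]_n] g,
  (Loo_norm (norm2 \o g) < +oo)%E &
  forall phi, test_function phi -> forall i,
    (\int[lambda]_x (f x * partial i phi x)%:E =
     - \int[lambda]_x (g x 0 i * phi x)%:E)%E].

(* Weak gradients are unique almost everywhere, so that the infimum is over at
   most one value; it is +oo if there is no bounded weak gradient. *)
Definition gradient_norm f : \bar R :=
  ereal_inf [set Loo_norm (norm2 \o g) | g in Loo_weak_gradient f].

Definition W1oo_norm f : \bar R := Order.max (Loo_norm f) (gradient_norm f).

(* Every class of W^{1,oo} has a unique continuous representative; it is the
   one to integrate against measures with atoms. *)
Definition W1oo : set ('rV[R]_n -> R) :=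
  [set f | continuous f /\ (W1oo_norm f < +oo)%E].

End sobolev.

(* Does not depend on the choice of the Hahn decomposition. *)
Definition charge_integral d (T : measurableType d) (R : realType)
    (nu : {charge set T -> \bar R}) (f : T -> \bar R) : \bar R :=
  let: exist P hP := cid (Hahn_decomposition nu) in
  let: exist N nuPN := cid hP in
  (\int[jordan_pos nuPN]_x f x - \int[jordan_neg nuPN]_x f x)%E.

Definition BL_norm {R : realType} (n : nat)
    (nu : {charge set 'rV[R]_n -> \bar R}) : \bar R :=
  ereal_sup [set (charge_integral nu (EFin \o f) *
                  (fine (W1oo_norm f))^-1%:E)%E |
             f in [set f | W1oo f /\ f <> cst 0]].

Section empirical_measure.
Context d (T : measurableType d) (R : realType) (N : nat) (x : 'I_N -> T).

Definition empirical_measure (A : set T) : \bar R :=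
  ((N%:R^-1 : R)%R%:E * \sum_(i < N) (\d_(x i) A : \bar R))%E.

Let empirical_measureE : empirical_measure = mscale (N%:R^-1 : R)%:nng
  (msum (fun k => \d_(nth point [seq x i | i <- enum 'I_N] k)) N).
Proof.
apply/funext => A; rewrite /empirical_measure /mscale /msum; congr (_ * _)%E.
apply: eq_bigr => i _.
by rewrite (nth_map i) ?size_enum_ord// nth_ord_enum.
Qed.

Let empirical_measure0 : empirical_measure set0 = 0%E.
Proof. by rewrite empirical_measureE measure0. Qed.

Let empirical_measure_ge0 A : (0 <= empirical_measure A)%E.
Proof. by rewrite empirical_measureE. Qed.

Let empirical_measure_sigma_additive : semi_sigma_additive empirical_measure.
Proof. rewrite empirical_measureE; exact: measure_semi_sigma_additive. Qed.

HB.instance Definition _ := isMeasure.Build _ _ _ empirical_measure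
  empirical_measure0 empirical_measure_ge0 empirical_measure_sigma_additive.

Let empirical_measure_fin_num : fin_num_fun empirical_measure.
Proof.
move=> A mA; rewrite /empirical_measure fin_numM//.
by apply/sum_fin_numP => i _ _; rewrite diracE.
Qed.

HB.instance Definition _ := Measure_isFinite.Build _ _ _ empirical_measure
  empirical_measure_fin_num.

End empirical_measure.
Arguments empirical_measure {d T R N} x.

(* Main.v *)
(** A test function that is of size r on the support of nu_N and small away
    from it is obtained from Gaussian bumps y |-> r exp (- |y - x_i|^2 / r^2),
    whose maximum over i is replaced by the smooth maximum
    eps ln (sum_i exp (bump_i / eps)). The gradient of a smooth maximum is a
    convex combination of the gradients of the bumps, hence bounded
    independently of N and r, whereas the value exceeds the maximum by at most
    eps ln N, which eps = r / (8 N) makes harmless. Since mu_N has density at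
    most M, it gives mass at most N M (4 r)^d to the cubes of half-side 2 r
    around the points x_i, so r = c N^(-1/d) with c small leaves at least a
    fixed fraction of r between the two integrals. As the test function is C^1,
    that its gradient is its weak gradient reduces, by the product rule, to the
    vanishing of the integral of a partial derivative of a compactly supported
    function: Fubini and the fundamental theorem of calculus. *)

Require Import Defs.
From mathcomp Require Import all_boot all_order all_algebra.
From mathcomp Require Import all_classical all_reals all_analysis.
From mathcomp Require Import measurable_realfun ess_sup_inf ring lra.
Set Implicit Arguments.
Unset Strict Implicit.
Unset Printing Implicit Defensive.
Import Order.TTheory GRing.Theory Num.Theory.
Import numFieldNormedType.Exports.
Local Open Scope classical_set_scope.
Local Open Scope ring_scope.
Local Open Scope charge_scope.

(** * Borel sets and continuous functions for the coordinate sigma-algebra *)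

Section measurability_rV.
Context {R : realType} {n : nat}.
Implicit Types (f : 'rV[R]_n -> R) (x : 'rV[R]_n).

Lemma measurable_box_rV (I : 'I_n -> interval R) :
  measurable [set x : 'rV[R]_n | forall i, x 0 i \in I i].
Proof.
rewrite (_ : [set _ | _] = \bigcap_(i in [set: 'I_n])
    (coord_rV i @^-1` [set` I i])).
  apply: (@fin_bigcap_measurable _ 'rV[R]_n) => // i _.
  by rewrite -[X in measurable X]setTI; exact: measurable_coord_rV.
by apply/seteqP; split=> x /= Bx i => [_|]; exact: Bx.
Qed.

(** Boxes with rational corners form a countable base of the topology, and each box is measurable as
    a finite intersection of coordinate preimages. The union runs over all pairs of corners, a box
    not contained in [U] being replaced by the empty set. *)
Lemma open_measurable_rV (U : set 'rV[R]_n) : open U -> measurable U.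
Proof.
move=> oU.
pose cube (p : 'rV[rat]_n * 'rV[rat]_n) := [set x : 'rV[R]_n |
  forall i, x 0 i \in `]ratr (p.1 0 i), ratr (p.2 0 i)[].
pose F p := if `[< cube p `<=` U >] then cube p else set0.
have -> : U = \bigcup_p F p.
  apply/seteqP; split => [x Ux|x [p _]]; last first.
    by rewrite /F; case: asboolP => // pU; exact: pU.
  have /nbhs_ballP[e /= e0 eU] : nbhs x U by exact: open_nbhs_nbhs.
  have lo i : {q : rat | ratr q \in `]x 0 i - e, x 0 i[}.
    by apply/cid/rat_in_itvoo; rewrite ltrBlDr ltrDl.
  have hi i : {q : rat | ratr q \in `]x 0 i, x 0 i + e[}.
    by apply/cid/rat_in_itvoo; rewrite ltrDl.
  exists (\row_i sval (lo i), \row_i sval (hi i)) => //.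
  rewrite /F; case: asboolP => [_ i /=|[y xy]].
    rewrite !mxE; case: (lo i) (hi i) => [a /= /itvP xa] [b /= /itvP xb].
    by rewrite in_itv/= xa xb.
  apply: eU; split => // i j; rewrite (ord1 i) {i}.
  move: (xy j); rewrite /ball/= !mxE ltr_distlC.
  case: (lo j) (hi j) => [a /= /itvP xa] [b /= /itvP xb] /itvP ayb.
  apply/andP; split.
    by rewrite (@lt_trans _ _ (ratr a)) ?xa ?ayb.
  by rewrite (@lt_trans _ _ (ratr b)) ?xb ?ayb.
apply: countable_bigcupT_measurable => // p; rewrite /F; case: ifP => // _.
exact: (measurable_box_rV (fun i => `]ratr (p.1 0 i), ratr (p.2 0 i)[)).
Qed.

Lemma continuous_measurable_rV f : continuous f -> measurable_fun setT f.
Proof.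
move=> /continuousP cf.
apply: (measurability _ (RGenOpens.measurableE R)).
move=> _ [_ [a [b ->] <-]]; rewrite setTI.
by apply: open_measurable_rV; apply: cf; exact: interval_open.
Qed.

End measurability_rV.

(** * Vanishing integrals of partial derivatives *)

Section integral_derivative.
Context {R : realType}.

(** Restriction to a line: it brings directional derivatives within reach of the one-variable chain
    rule and of the fundamental theorem of calculus on Fubini slices. *)
Lemma is_derive1P {V : normedModType R} (f : V -> R) (x v : V) (df : R) :
  is_derive x v f df <-> is_derive (0 : R) 1 (fun t => f (t *: v + x)) df.
Proof.
have E : 'D_v f x = 'D_1 (fun t : R => f (t *: v + x)) 0.
  rewrite /derive; set F := (X in X @ _); set G := (X in _ = lim (X @ _)).
  suff -> : F = G by [].
  by apply/funext => t; rewrite /F /G /= addr0 scale0r add0r [_%:A]mulr1.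
split=> [[dfx <-]|[dfx <-]].
  by split; [exact: (derivable1P f x v).1|rewrite E].
by split; [exact: (derivable1P f x v).2|rewrite E].
Qed.

Lemma integrable_rV n (g : 'rV[R]_n -> R) (A B : R) :
  continuous g -> (forall x, `|g x| <= B) ->
  (forall (x : 'rV[R]_n) j, A < `|x 0 j| -> g x = 0) ->
  (lebesgue_rV n).-integrable setT (EFin \o g).
Proof.
move=> cg gB gA.
(* [A] may be negative; [|A|] keeps the bounds of the box in order, as its volume formula
   requires. *)
pose D := [set x : 'rV[R]_n | forall i, x 0 i \in `[- `|A|, `|A|]].
have mD : measurable D by exact: (measurable_box_rV (fun=> `[- `|A|, `|A|])).
have mg : measurable_fun setT g by exact: continuous_measurable_rV.
have -> : EFin \o g = (EFin \o g) \_ D.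
  apply/funext => x; rewrite patchE; case: ifPn => //= /negP.
  rewrite inE => /existsNP[i /negP]; rewrite in_itv/= -ler_norml -ltNge => Ai.
  by rewrite (gA x i) // (le_lt_trans _ Ai) ?ler_norm.
apply/(integrable_mkcond _ mD).
apply: measurable_bounded_integrable => //.
- pose a : 'rV[R]_n := const_mx (- `|A|); pose b : 'rV[R]_n := const_mx `|A|.
  have -> : D = [set x | forall i, x 0 i \in `[a 0 i, b 0 i]].
    by apply/seteqP; split=> x /= + i => /(_ i); rewrite !mxE.
  have ab i : a 0 i <= b 0 i by rewrite !mxE ge0_cp.
  have := lebesgue_rV_box ab; set u := lebesgue_rV n _ => uE.
  by have : (u < +oo)%E by rewrite uE ltry.
- exact: measurable_funTS.
- exists B; split; first exact: num_real.
  by move=> M BM x _ /=; rewrite (le_trans (gB _))// ltW.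
Qed.

(** The fundamental theorem of calculus on [[- C, C]], where [C] is positive and strictly beyond
    [A], so that [h] vanishes at both ends. *)
Lemma integral_derivative_line_eq0 (h g : R -> R) (A : R) :
  (forall t : R, is_derive t 1 h (g t)) -> continuous g ->
  (forall t, A < `|t| -> h t = 0) -> (forall t, A < `|t| -> g t = 0) ->
  (\int[lebesgue_measure]_t (g t)%:E = 0)%E.
Proof.
move=> hg cg h0 g0; pose C := `|A| + 1.
have AC : A < C by rewrite /C (le_lt_trans (ler_norm A))// ltrDl.
have C0 : 0 < C by rewrite /C ltr_wpDl.
have ch : continuous h.
  move=> t; apply: differentiable_continuous; apply/derivable1_diffP.
  by case: (hg t).
have -> : (fun t => (g t)%:E) = (EFin \o g) \_ `[- C, C].
  apply/funext => t; rewrite patchE; case: ifPn => //= /negP.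
  rewrite inE/= in_itv/= -ler_norml => /negP; rewrite -ltNge => Ct.
  by rewrite g0// (lt_trans AC).
rewrite -integral_mkcond (@continuous_FTC2 R g h).
- by rewrite !h0 ?subee// ?normrN gtr0_norm.
- by rewrite (lt_trans _ C0)// oppr_lt0.
- exact: continuous_subspaceT.
- split; first by move=> t _; case: (hg t).
  + exact/cvg_at_right_filter/ch.
  + exact/cvg_at_left_filter/ch.
- by move=> t _; rewrite derive1E; case: (hg t).
Qed.

Lemma continuous_cons_rVl n (y : 'rV[R]_n) :
  continuous (fun t : R => cons_rV (t, y)).
Proof.
move=> t S /nbhs_ballP[e /= e0 eS]; apply/nbhs_ballP; exists e => //= s ts.
apply: eS; split => // i j; rewrite !mxE; case: (unlift _ _) => [k|] //=.
exact: ballxx.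
Qed.

Lemma continuous_cons_rVr n (t : R) :
  continuous (fun y : 'rV[R]_n => cons_rV (t, y)).
Proof.
move=> y S /nbhs_ballP[e /= e0 eS]; apply/nbhs_ballP; exists e => //= z [_ yz].
apply: eS; split => // i j; rewrite !mxE; case: (unlift _ _) => [k|] /=.
  exact: yz.
exact: ballxx.
Qed.

(** Induction on the dimension, splitting off the first coordinate. By Fubini, the inner integral
    can be taken over the variables that include the [i]-th: the remaining coordinates (induction
    hypothesis) or the first one (the case of the line). A support condition stated coordinate by
    coordinate passes to slices. *)
Lemma integral_derivative_rV_eq0 n (i : 'I_n) (h g : 'rV[R]_n -> R) (A B : R) :
  (forall x : 'rV[R]_n, is_derive x (delta_mx 0 i) h (g x)) ->
  continuous g -> (forall x, `|g x| <= B) ->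
  (forall (x : 'rV[R]_n) j, A < `|x 0 j| -> h x = 0) ->
  (forall (x : 'rV[R]_n) j, A < `|x 0 j| -> g x = 0) ->
  (\int[lebesgue_rV n]_x (g x)%:E = 0)%E.
Proof.
elim: n i h g => [[]//|n IHn] i h g hg cg gB h0 g0.
have ig := integrable_rV cg gB g0.
have mg : measurable_fun setT (EFin \o g).
  by apply/measurable_EFinP; exact: continuous_measurable_rV.
pose G := (EFin \o g) \o @cons_rV R n.
have iG : (lebesgue_measure \x lebesgue_rV n)%E.-integrable setT G.
  apply/integrableP; split.
    by apply: measurableT_comp => //; exact: measurable_cons_rV.
  have [_] := integrableP _ _ _ ig.
  rewrite /= /lebesgue_cons.
  rewrite (ge0_integral_pushforward (@measurable_cons_rV R n))//.
  by apply/measurable_EFinP/measurableT_comp => //; exact/measurable_EFinP.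
(* By construction, [lebesgue_rV n.+1] is the pushforward of the product measure along [cons_rV]. *)
have -> : (\int[lebesgue_rV n.+1]_x (g x)%:E =
    \int[lebesgue_measure \x lebesgue_rV n]_p G p)%E.
  rewrite /= /lebesgue_cons.
  by rewrite (integral_pushforward (@measurable_cons_rV R n) mg iG measurableT).
case: (unliftP ord0 i) => [j|] iE.
- rewrite -integral12_prod_meas1// integral0_eq// => t _; rewrite /fubini_F.
  apply: (IHn j (fun y => h (cons_rV (t, y))) (fun y => g (cons_rV (t, y)))).
  (* Moving [y] in direction [j] moves [cons_rV (t, y)] in direction [lift ord0 j] and fixes the
     first coordinate. *)
  + move=> y; apply/is_derive1P; have /is_derive1P := hg (cons_rV (t, y)).
    rewrite iE; congr (is_derive _ _ _ _); apply/funext => s; congr h.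
    apply/rowP => k; rewrite !mxE; case: (unliftP ord0 k) => [l|] -> /=.
      by rewrite !mxE (inj_eq lift_inj).
    by rewrite mulr0 add0r.
  + by move=> y; apply: continuous_comp;
      [exact: continuous_cons_rVr|exact: cg].
  + by move=> y; exact: gB.
  + by move=> y k yk; apply: (h0 _ (lift ord0 k)); rewrite mxE liftK.
  + by move=> y k yk; apply: (g0 _ (lift ord0 k)); rewrite mxE liftK.
- rewrite -integral21_prod_meas1// integral0_eq// => y _; rewrite /fubini_G.
  apply: (@integral_derivative_line_eq0 (fun t => h (cons_rV (t, y)))
    (fun t => g (cons_rV (t, y))) A).
  + move=> t; apply/is_derive1P; have /is_derive1P := hg (cons_rV (t, y)).
    rewrite iE; congr (is_derive _ _ _ _); apply/funext => s; congr h.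
    apply/rowP => k; rewrite !mxE; case: (unliftP ord0 k) => [l|] -> //=.
    by rewrite mulr0 add0r.
  + by move=> t; apply: continuous_comp;
      [exact: continuous_cons_rVl|exact: cg].
  + by move=> t tA; apply: (h0 _ ord0); rewrite mxE unlift_none.
  + by move=> t tA; apply: (g0 _ ord0); rewrite mxE unlift_none.
Qed.

End integral_derivative.

(** * Classical gradients as weak gradients, and bounds on the Sobolev norm *)

Section weak_gradient.
Context {R : realType} {n : nat}.
Implicit Types (f phi : 'rV[R]_n -> R) (g : 'rV[R]_n -> 'rV[R]_n).
Implicit Types x : 'rV[R]_n.

Lemma closure_support0 phi x : ~ closure [set x | phi x != 0] x ->
  \forall y \near x, phi y = 0.
Proof.
move=> /existsNP[S /not_implyP[xS /nonemptyPn S0]].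
near=> y; apply/eqP/negP => /negP phiy.
have : (set0 : set 'rV[R]_n) y by rewrite -S0; split => //; near: y.
by [].
Unshelve. all: by end_near. Qed.

Lemma partial_support phi i x : ~ closure [set x | phi x != 0] x ->
  partial i phi x = 0.
Proof.
move=> /closure_support0 phi0; rewrite /partial.
by rewrite (@near_eq_derive _ _ _ phi (cst 0)) ?derive_cst.
Qed.

Lemma compact_support_bounded phi (K : set 'rV[R]_n) : compact K ->
  continuous phi -> (forall x, ~ K x -> phi x = 0) ->
  exists B, forall x, `|phi x| <= B.
Proof.
move=> cK cphi phi0.
have /compact_bounded[B [_ Bphi]] : compact (phi @` K).
  by apply: continuous_compact => //; exact: continuous_subspaceT.
exists (`|B| + 1) => x; have [Kx|nKx] := pselect (K x).
  apply: (Bphi (`|B| + 1)); first by rewrite (le_lt_trans (ler_norm _))// ltrDl.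
  by exists x.
by rewrite phi0// normr0 addr_ge0.
Qed.

Lemma normr_coord_le x i : `|x 0 i| <= `|x|.
Proof. by rewrite [leRHS]mx_normrE; exact: (le_bigmax _ _ (0, i)). Qed.

(** By the product rule, the sum of the two integrands is the [i]-th partial derivative of
    [f * phi], which vanishes outside the support of [phi]. *)
Lemma integral_by_parts_rV f (df phi : 'rV[R]_n -> R) (i : 'I_n) (C C' : R) :
  continuous f -> (forall x, `|f x| <= C) ->
  continuous df -> (forall x, `|df x| <= C') ->
  (forall x, is_derive x (delta_mx 0 i) f (df x)) -> test_function phi ->
  (\int[lebesgue_rV n]_x (f x * partial i phi x)%:E =
   - \int[lebesgue_rV n]_x (df x * phi x)%:E)%E.
Proof.
move=> cf fC cdf dfC fdf [sphi]; set K := closure _ => cK.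
have [cphi dphi] := sphi [::].
have [cphi' _] := sphi [:: i].
have phi0 x : ~ K x -> phi x = 0.
  by move=> /closure_support0; exact: nbhs_singleton.
have phi'0 x : ~ K x -> partial i phi x = 0 by exact: partial_support.
have [B phiB] := compact_support_bounded cK cphi phi0.
have [B' phiB'] := compact_support_bounded cK cphi' phi'0.
have [A [_ KA]] := compact_bounded cK.
(* [compact_bounded] bounds [K] by every real strictly above [A], whence [A + 1]. *)
have nK x j : A + 1 < `|x 0 j| -> ~ K x.
  move=> Aj /(KA (A + 1)); rewrite ltrDl => /(_ ltr01); apply/negP.
  by rewrite -ltNge (lt_le_trans Aj)// normr_coord_le.
pose h1 := fun x => f x * partial i phi x.
pose h2 := fun x => df x * phi x.
have ch1 : continuous h1 by move=> x; exact: (continuousM (cf x) (cphi' x)).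
have ch2 : continuous h2 by move=> x; exact: (continuousM (cdf x) (cphi x)).
have h1B x : `|h1 x| <= C * B'.
  by rewrite /h1 normrM; apply: ler_pM; [| |exact: fC|exact: phiB'].
have h2B x : `|h2 x| <= C' * B.
  by rewrite /h2 normrM; apply: ler_pM; [| |exact: dfC|exact: phiB].
have h10 x j : A + 1 < `|x 0 j| -> h1 x = 0.
  by move=> /nK Kx; rewrite /h1 phi'0// mulr0.
have h20 x j : A + 1 < `|x 0 j| -> h2 x = 0.
  by move=> /nK Kx; rewrite /h2 phi0// mulr0.
have i1 := integrable_rV ch1 h1B h10.
have i2 := integrable_rV ch2 h2B h20.
have : (\int[lebesgue_rV n]_x (h1 x + h2 x)%:E = 0)%E.
  apply: (@integral_derivative_rV_eq0 R n i (f * phi) _ (A + 1)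
    (C * B' + C' * B)).
  - move=> x; have fx := fdf x.
    have phix : is_derive x (delta_mx 0 i) phi (partial i phi x).
      by apply: derivableP; exact: dphi.
    apply: is_derive_eq; rewrite /h1 /h2 /GRing.scale/=.
    by rewrite [phi x * _]mulrC.
  - by move=> x; exact: (continuousD (ch1 x) (ch2 x)).
  - by move=> x; rewrite (le_trans (ler_normD _ _))// lerD.
  - move=> x j /nK Kx; transitivity (f x * phi x) => //.
    by rewrite (phi0 _ Kx) mulr0.
  - by move=> x j Aj; rewrite (h10 _ _ Aj) (h20 _ _ Aj) addr0.
(* Both integrals are finite, so a zero sum in the extended reals does make them opposite. *)
rewrite integralD_EFin//= -/h1 -/h2.
have := integrable_fin_num measurableT i1.
have := integrable_fin_num measurableT i2.
rewrite /comp.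
case: (integral _ _ _) => //= b _; case: (integral _ _ _) => //= a _.
by move=> [/eqP]; rewrite addr_eq0 => /eqP ->.
Qed.

(** The norm ['N[_]_+oo] is the essential supremum only when the whole space has positive measure,
    and 0 otherwise. The unit cube settles this. *)
Lemma lebesgue_rV_setT_gt0 : (0 < lebesgue_rV n [set: 'rV[R]_n])%E.
Proof.
pose a : 'rV[R]_n := 0; pose b : 'rV[R]_n := const_mx 1.
pose D := [set x : 'rV[R]_n | forall i, x 0 i \in `[a 0 i, b 0 i]].
have mD : measurable D by exact: (measurable_box_rV (fun i => `[a 0 i, b 0 i])).
have D0 : (0 < lebesgue_rV n D)%E.
  have ab i : a 0 i <= b 0 i by rewrite !mxE.
  have := lebesgue_rV_box ab; rewrite -/D; set u := lebesgue_rV n _ => uE.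
  have : (0 < u)%E by rewrite uE lte_fin prodr_gt0// => i _; rewrite !mxE subr0.
  by [].
by apply: (lt_le_trans D0); apply: le_measure; rewrite ?inE.
Qed.

Lemma Loo_norm_le f (C : R) : (forall x, `|f x| <= C) -> (Loo_norm f <= C%:E)%E.
Proof.
move=> fC; rewrite /Loo_norm unlock lebesgue_rV_setT_gt0.
by apply: ess_sup_ler => x /=; rewrite lee_fin.
Qed.

(** A zero norm would make [f] vanish outside a null set; as [f] has no zero, that null set would be
    the whole space. Positivity matters because [BL_norm] divides by the Sobolev norm. *)
Lemma Loo_norm_gt0 f : continuous f -> (forall x, 0 < f x) -> (0 < Loo_norm f)%E.
Proof.
move=> cf f0; rewrite lt_neqAle Lnorm_ge0 andbT eq_sym.
apply/eqP => /Lnorm_eq0_eq0.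
have mf : measurable_fun setT (EFin \o f).
  by apply/measurable_EFinP; exact: continuous_measurable_rV.
move=> /(_ mf (ltry _)) [Z [mZ Z0 fZ]].
have : Z = setT.
  by rewrite -subTset => x _; apply: fZ => /= /(_ I) [] /eqP; rewrite gt_eqF.
by move: Z0 => /[swap] -> Z0; have := lebesgue_rV_setT_gt0; rewrite Z0 ltxx.
Qed.

Lemma norm2_le x : (forall i, `|x 0 i| <= 1) -> norm2 x <= n%:R.
Proof.
move=> x1; rewrite /norm2 -[leRHS]ger0_norm// -sqrtr_sqr ler_wsqrtr//.
rewrite (@le_trans _ _ (\sum_(i < n) 1))//.
  by apply: ler_sum => i _; rewrite -real_normK ?num_real// expr_le1.
(* The crude inequality n <= n^2 replaces the bound sqrt n by n. *)
rewrite sumr_const card_ord -natrX ler_nat.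
by case: (n) => // k; rewrite -mulnn leq_pmulr.
Qed.

(** Integration by parts makes the continuous pointwise gradient [g] a weak gradient, so its norm
    bounds the infimum in [gradient_norm]. *)
Lemma W1oo_norm_le f g (C : R) : continuous f -> (forall x, `|f x| <= C) ->
  (forall i, continuous (fun x => g x 0 i)) ->
  (forall i x, `|g x 0 i| <= 1) ->
  (forall i x, is_derive x (delta_mx 0 i) f (g x 0 i)) ->
  (W1oo_norm f <= (Num.max C n%:R)%:E)%E.
Proof.
move=> cf fC cg g1 fg.
have gn : (Loo_norm (@norm2 R n \o g) <= n%:R%:E)%E.
  apply: Loo_norm_le => x /=; rewrite ger0_norm ?sqrtr_ge0//.
  by apply: norm2_le => i.
rewrite /W1oo_norm ge_max; apply/andP; split.
  by rewrite (le_trans (Loo_norm_le fC))// lee_fin le_max lexx.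
apply: (@le_trans _ _ (n%:R%:E)); last by rewrite lee_fin le_max lexx orbT.
apply: (le_trans _ gn); apply: ereal_inf_lbound; exists g => //; split.
- by apply: measurable_fun_rV => i; exact: (continuous_measurable_rV (cg i)).
- exact: le_lt_trans gn (ltry _).
- move=> phi tphi i; exact: (integral_by_parts_rV cf fC (cg i) (g1 i) (fg i) tphi).
Qed.

End weak_gradient.

(** * Integration against a difference of measures, and the density bound *)

Section charge_integral.
Context d (T : measurableType d) (R : realType).
Local Open Scope ereal_scope.

Lemma finite_measure_integral_fin_num (m : {finite_measure set T -> \bar R})
    (f : T -> R) (C : R) : measurable_fun setT f ->
  (forall x, `|f x| <= C)%R -> \int[m]_x (f x)%:E \is a fin_num.
Proof.
move=> mf fC; apply: integrable_fin_num => //.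
apply: measurable_bounded_integrable => //.
  by rewrite ltey_eq fin_num_measure.
exists C; split; first exact: num_real.
by move=> M CM x _ /=; rewrite (le_trans (fC _))// ltW.
Qed.

(** The Jordan parts need not be [m1] and [m2], but two decompositions of one charge integrate
    alike; boundedness of [f] makes all four integrals finite. *)
Lemma charge_integral_sub (m1 m2 : {finite_measure set T -> \bar R})
    (f : T -> R) (C : R) : measurable_fun setT f ->
  (forall x, 0 <= f x)%R -> (forall x, f x <= C)%R ->
  charge_integral (cadd (charge_of_finite_measure m1)
    (copp (charge_of_finite_measure m2))) (EFin \o f) =
  \int[m1]_x (f x)%:E - \int[m2]_x (f x)%:E.
Proof.
move=> mf f0 fC; rewrite /charge_integral.
case: cid => P hP; case: cid => N nuPN /=.
have fnormC x : (`|f x| <= C)%R by rewrite ger0_norm.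
have F (m : {finite_measure set T -> \bar R}) :
  \int[m]_x (f x)%:E \is a fin_num.
  exact: finite_measure_integral_fin_num mf fnormC.
(* m1 - m2 = pos - neg, read without subtraction as pos + m2 = neg + m1 *)
have : \int[measure_add (jordan_pos nuPN) m2]_x (f x)%:E =
       \int[measure_add (jordan_neg nuPN) m1]_x (f x)%:E.
  apply: eq_measure_integral => A mA _.
  transitivity (jordan_pos nuPN A + m2 A); first exact: measure_addE.
  transitivity (jordan_neg nuPN A + m1 A); last first.
    by apply/esym; exact: measure_addE.
  have : m1 A - m2 A = jordan_pos nuPN A - jordan_neg nuPN A.
    by rewrite [LHS](jordan_decomp nuPN mA) /cadd/= cscaleN1.
  have : m1 A \is a fin_num by exact: fin_num_measure.
  have : m2 A \is a fin_num by exact: fin_num_measure.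
  have : jordan_pos nuPN A \is a fin_num by exact: fin_num_measure.
  have : jordan_neg nuPN A \is a fin_num by exact: fin_num_measure.
  case: (jordan_neg _ _) => // a _; case: (jordan_pos _ _) => // b _.
  case: (m2 A) => // b' _; case: (m1 A) => // a' _.
  by rewrite -!EFinN -!EFinD => -[E]; congr EFin; lra.
have mEf : measurable_fun setT (EFin \o f) by exact/measurable_EFinP.
rewrite !ge0_integral_measure_add//; last 2 first.
  by move=> x _; rewrite lee_fin.
  by move=> x _; rewrite lee_fin.
move: (F (jordan_pos nuPN)) (F (jordan_neg nuPN)) (F m1) (F m2) => /=.
rewrite /comp.
case: (integral (jordan_pos _) _ _) => // a _.
case: (integral (jordan_neg _) _ _) => // b _.
case: (integral m1 _ _) => // a' _; case: (integral m2 _ _) => // b' _.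
by rewrite -!EFinN -!EFinD => -[E]; congr EFin; lra.
Qed.

(** By Radon-Nikodym, [m A] is the integral over [A] of a density that is at most [M] almost
    everywhere. *)
Lemma measure_le_density (l : {sigma_finite_measure set T -> \bar R})
    (m : {finite_measure set T -> \bar R}) (M : R) (A : set T) :
  m `<< l -> 0 < l setT ->
  'N[l]_+oo['d (charge_of_finite_measure m) '/d l] <= M%:E ->
  measurable A -> m A <= M%:E * l A.
Proof.
move=> ml l0 dM mA.
have ml' : charge_of_finite_measure m `<< l by [].
have -> : m A = \int[l]_(x in A) ('d (charge_of_finite_measure m) '/d l) x.
  by rewrite -Radon_Nikodym_integral.
have iD := Radon_Nikodym_integrable ml'.
have dM' : \forall x \ae l, `|('d (charge_of_finite_measure m) '/d l) x| <= M%:E.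
  by apply/ess_supP; move: dM; rewrite unlock l0.
rewrite -integral_cst//.
apply: (@le_trans _ _ (\int[l]_(x in A) `|('d (charge_of_finite_measure m) '/d l) x|)).
  apply: le_trans (lee_abs _) _; apply: le_abse_integral => //.
  exact: measurable_funTS (measurable_int _ iD).
apply: ae_ge0_le_integral => //.
- apply: measurableT_comp => //.
  exact: measurable_funTS (measurable_int _ iD).
(* [M] is nonnegative since it dominates a norm. *)
- move=> x _; exact: le_trans (Lnorm_ge0 _ _ _) dM.
- by apply: filterS dM' => x.
Qed.

End charge_integral.

(** * The log-sum-exp maximum and its derivative *)

Section smooth_max.
Context {R : realType} {V : normedModType R}.
Implicit Types (x v : V).

Lemma is_derive_comp_real (u : V -> R) (F : R -> R) x v (du dF : R) :
  is_derive (u x) 1 F dF -> is_derive x v u du ->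
  is_derive x v (F \o u) (dF * du).
Proof.
move=> FdF /is_derive1P udu; apply/is_derive1P.
apply: (@is_derive1_comp R F (fun t => u (t *: v + x))) => //.
by rewrite scale0r add0r.
Qed.

Context {N : nat}.
Implicit Types (u du : 'I_N -> V -> R) (eps : R).

(** The unnormalized softmax weight of index [i] at temperature [eps]. *)
Definition exp_weight eps u i x := expR (eps^-1 * u i x).

Definition smooth_max eps u x := eps * ln (\sum_i exp_weight eps u i x).

(* A convex combination of the [du i x]. *)
Definition smooth_max_derivative eps u du x :=
  (\sum_i exp_weight eps u i x * du i x) / \sum_i exp_weight eps u i x.

Lemma exp_weight_sum_gt0 eps u x : (0 < N)%N ->
  0 < \sum_i exp_weight eps u i x.
Proof.
move=> N0; rewrite (bigD1 (Ordinal N0))//= ltr_pwDl ?expR_gt0//.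
by apply: sumr_ge0 => i _; exact: expR_ge0.
Qed.

Lemma continuous_exp_weight eps u i :
  continuous (u i) -> continuous (exp_weight eps u i).
Proof.
move=> cu x; apply: (continuous_comp (f := fun x => eps^-1 * u i x)).
  exact: (continuousM (@cst_continuous _ _ _ _) (cu x)).
exact: continuous_expR.
Qed.

Lemma continuous_sum_real (F : 'I_N -> V -> R) : (forall i, continuous (F i)) ->
  continuous (fun x => \sum_i F i x).
Proof.
by move=> cF; apply: continuous_big => [|i _]; [exact: add_continuous|exact: cF].
Qed.

(** A single positive term is at most the whole sum of exponentials. *)
Lemma smooth_max_ge eps u x i : 0 < eps -> u i x <= smooth_max eps u x.
Proof.
move=> eps0; rewrite /smooth_max -ler_pdivrMl// -ler_expR lnK.
  rewrite (bigD1 i)//= lerDl; apply: sumr_ge0 => j _; exact: expR_ge0.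
by rewrite posrE; apply: exp_weight_sum_gt0; case: (N) i => [[]|].
Qed.

(** Each of the [N] exponentials is at most exp (m / eps); the factor [N] becomes the additive error
    under the logarithm. *)
Lemma smooth_max_le eps u x m : 0 < eps -> (0 < N)%N ->
  (forall i, u i x <= m) -> smooth_max eps u x <= m + eps * ln N%:R.
Proof.
move=> eps0 N0 um; rewrite /smooth_max addrC -ler_pdivlMl// mulrDr mulKf ?gt_eqF//.
rewrite -ler_expR lnK ?posrE ?exp_weight_sum_gt0// expRD lnK ?posrE ?ltr0n//.
rewrite mulr_natl -[X in _ *+ X]card_ord -sumr_const; apply: ler_sum => i _.
by rewrite ler_expR ler_pM2l ?invr_gt0.
Qed.

Lemma smooth_max_derivative_le eps u du x C : (0 < N)%N ->
  (forall i, `|du i x| <= C) -> `|smooth_max_derivative eps u du x| <= C.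
Proof.
move=> N0 duC; have S0 := exp_weight_sum_gt0 eps u x N0.
rewrite normrM normfV (gtr0_norm S0) ler_pdivrMr// mulr_sumr.
apply: le_trans (ler_norm_sum _ _ _) _; apply: ler_sum => i _.
by rewrite normrM ger0_norm ?expR_ge0// mulrC ler_wpM2r ?expR_ge0.
Qed.

Lemma is_derive_smooth_max eps u du x v : 0 < eps -> (0 < N)%N ->
  (forall i, is_derive x v (u i) (du i x)) ->
  is_derive x v (smooth_max eps u) (smooth_max_derivative eps u du x).
Proof.
move=> eps0 N0 udu; have S0 := exp_weight_sum_gt0 eps u x N0.
have dw i : is_derive x v (exp_weight eps u i)
    (exp_weight eps u i x * (eps^-1 * du i x)).
  have dudu := udu i.
  apply: (is_derive_comp_real (u := eps^-1 \*: u i)).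
have dS := is_derive_sum dw.
have dln : is_derive ((\sum_i exp_weight eps u i) x) 1 (@ln R)
   ((\sum_i exp_weight eps u i x)^-1).
  by rewrite fct_sumE; exact: is_derive1_ln.
have := is_deriveZ eps (is_derive_comp_real dln dS).
rewrite /GRing.scale/=.
set D := (X in is_derive _ _ _ X -> _) => H.
have -> : smooth_max eps u = eps \*: (@ln R \o \sum_i exp_weight eps u i).
  by apply/funext => y; rewrite /smooth_max /= fct_sumE.
apply: is_derive_eq; rewrite /D /smooth_max_derivative.
(* The [eps] outside the logarithm cancels the [eps^-1] coming from the exponents. *)
rewrite mulrCA [in RHS]mulrC; congr (_ * _); rewrite mulr_sumr.
by apply: eq_bigr => i _; rewrite mulrCA mulVKf ?gt_eqF.
Qed.

Lemma continuous_smooth_max eps u : (0 < N)%N ->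
  (forall i, continuous (u i)) -> continuous (smooth_max eps u).
Proof.
move=> N0 cu x.
have cS : continuous (fun x => \sum_i exp_weight eps u i x).
  by apply: continuous_sum_real => i; exact: continuous_exp_weight.
have cl : {for x, continuous (fun x => ln (\sum_i exp_weight eps u i x))}.
  apply: (continuous_comp (cS x)); apply: continuous_ln.
  exact: exp_weight_sum_gt0.
exact: (continuousM (@cst_continuous _ _ _ _) cl).
Qed.

Lemma continuous_smooth_max_derivative eps u du : (0 < N)%N ->
  (forall i, continuous (u i)) -> (forall i, continuous (du i)) ->
  continuous (smooth_max_derivative eps u du).
Proof.
move=> N0 cu cdu x.
have cS : continuous (fun x => \sum_i exp_weight eps u i x).
  by apply: continuous_sum_real => i; exact: continuous_exp_weight.
have cT : continuous (fun x => \sum_i exp_weight eps u i x * du i x).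
  apply: (@continuous_sum_real (fun i y => exp_weight eps u i y * du i y)) => i y.
  have cw : {for y, continuous (exp_weight eps u i)}.
    exact: continuous_exp_weight.
  exact: (continuousM cw (cdu i y)).
have S0 : \sum_i exp_weight eps u i x != 0.
  by rewrite gt_eqF// exp_weight_sum_gt0.
exact: (continuousM (cT x) (continuousV S0 (cS x))).
Qed.

End smooth_max.

(** * Gaussian bumps *)

Section gaussian_bump.
Context {R : realType} {n : nat}.
Implicit Types (p x : 'rV[R]_n) (r : R).

(** Height and width are both [r], so that the gradient is bounded independently of [r]. *)
Definition gaussian_bump p r x :=
  r * expR (- \sum_j ((x 0 j - p 0 j) / r) ^+ 2).

Definition gaussian_bump_partial p r (k : 'I_n) x :=
  - 2 * ((x 0 k - p 0 k) / r) * expR (- \sum_j ((x 0 j - p 0 j) / r) ^+ 2).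

Lemma is_derive_coord x v (j : 'I_n) : is_derive x v (fun y => y 0 j) (v 0 j).
Proof.
apply/is_derive1P.
have -> : (fun t : R => (t *: v + x) 0 j) = v 0 j \*: id + cst (x 0 j).
  by apply/funext => t; rewrite !mxE mulrC.
apply: is_derive_eq.
by rewrite addr0 [_ *: 1]mulr1.
Qed.

Lemma is_derive_gaussian_bump p r k x : r != 0 ->
  is_derive x (delta_mx 0 k) (gaussian_bump p r) (gaussian_bump_partial p r k x).
Proof.
move=> r0; pose z j (y : 'rV[R]_n) := (y 0 j - p 0 j) / r.
have dz j : is_derive x (delta_mx 0 k) (z j) ((j == k)%:R / r).
  have dx := is_derive_coord x (delta_mx 0 k) j.
  have -> : z j = r^-1 \*: ((fun y : 'rV[R]_n => y 0 j) - cst (p 0 j)).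
    by apply/funext => y; rewrite /z mulrC.
  by apply: is_derive_eq; rewrite subr0 mxE eqxx mulrC.
have dz2 j : is_derive x (delta_mx 0 k) (z j * z j)
    (z j x *: ((j == k)%:R / r) + z j x *: ((j == k)%:R / r)).
  exact: is_deriveM.
have dq := is_deriveN (is_derive_sum dz2).
have dF : is_derive ((- \sum_j z j * z j) x) 1 (@expR R)
    (expR ((- \sum_j z j * z j) x)) by exact: is_derive_expR.
have df := is_deriveZ r (is_derive_comp_real dF dq).
have qE y : (- \sum_j z j * z j) y = - \sum_j ((y 0 j - p 0 j) / r) ^+ 2.
  by congr (- _); rewrite fct_sumE; apply: eq_bigr => j _; rewrite expr2.
have -> : gaussian_bump p r = r \*: (@expR R \o (- \sum_j z j * z j)).
  by apply/funext => y; rewrite /gaussian_bump /= qE.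
apply: is_derive_eq; rewrite /gaussian_bump_partial qE.
(* Only the coordinate [j = k] varies in direction [k]. *)
rewrite (_ : \sum_j (_ + _) = 2 * z k x / r).
  by rewrite /z /GRing.scale/=; field.
rewrite (bigD1 k)//= big1 ?eqxx => [|j /negPf ->].
  by rewrite /GRing.scale/=; field.
by rewrite mul0r !scaler0 addr0.
Qed.

Lemma continuous_rescaled_coord p r j :
  continuous (fun x => (x 0 j - p 0 j) / r).
Proof.
move=> x; have cx : {for x, continuous (fun x => x 0 j)} by exact: coord_continuous.
exact: (continuousM (continuousB cx (@cst_continuous _ _ _ _)) (@cst_continuous _ _ _ _)).
Qed.

Lemma continuous_sqdist p r :
  continuous (fun x => \sum_j ((x 0 j - p 0 j) / r) ^+ 2).
Proof.
apply: (@continuous_sum_real _ _ _ (fun j x => ((x 0 j - p 0 j) / r) ^+ 2)) => j x.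
have c : {for x, continuous (fun x : 'rV[R]_n => (x 0 j - p 0 j) / r)}.
  exact: continuous_rescaled_coord.
exact: (continuousM c c).
Qed.

Lemma continuous_gaussian_bump p r : continuous (gaussian_bump p r).
Proof.
move=> x.
have cq : {for x, continuous (fun x => \sum_j ((x 0 j - p 0 j) / r) ^+ 2)}.
  exact: continuous_sqdist.
have ce := continuous_comp (continuousN cq) (@continuous_expR R _).
exact: (continuousM (@cst_continuous _ _ _ _) ce).
Qed.

Lemma continuous_gaussian_bump_partial p r k :
  continuous (gaussian_bump_partial p r k).
Proof.
move=> x.
have cq : {for x, continuous (fun x => \sum_j ((x 0 j - p 0 j) / r) ^+ 2)}.
  exact: continuous_sqdist.
have ce := continuous_comp (continuousN cq) (@continuous_expR R _).
have cz : {for x, continuous (fun x : 'rV[R]_n => (x 0 k - p 0 k) / r)}.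
  exact: continuous_rescaled_coord.
exact: (continuousM (continuousM (@cst_continuous _ _ _ _) cz) ce).
Qed.

Lemma gaussian_bump_partial_le p r k x : `|gaussian_bump_partial p r k x| <= 1.
Proof.
rewrite /gaussian_bump_partial; set q := \sum_j _; set z := _ / r.
have zq : z ^+ 2 <= q.
  by rewrite /q (bigD1 k)//= lerDl sumr_ge0// => j _; exact: sqr_ge0.
rewrite normrM (ger0_norm (expR_ge0 _)) expRN ler_pdivrMr ?expR_gt0// mul1r.
(* 2 |z| <= 1 + z^2 <= 1 + q <= exp q *)
apply: le_trans (expR_ge1Dx q).
have := sqr_ge0 (z - 1); have := sqr_ge0 (z + 1); rewrite sqrrB1 sqrrD1.
by rewrite ler_norml => *; apply/andP; split; lra.
Qed.

Lemma gaussian_bump_gt0 p r x : 0 < r -> 0 < gaussian_bump p r x.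
Proof. by move=> r0; rewrite mulr_gt0// expR_gt0. Qed.

Lemma gaussian_bump_le p r x : 0 <= r -> gaussian_bump p r x <= r.
Proof.
move=> r0; rewrite ler_piMr// -expR0 ler_expR oppr_le0 sumr_ge0// => j _.
exact: sqr_ge0.
Qed.

Lemma gaussian_bump_center p r : gaussian_bump p r p = r.
Proof.
rewrite /gaussian_bump big1 ?oppr0 ?expR0 ?mulr1// => j _.
by rewrite subrr mul0r expr0n.
Qed.

(** One coordinate off by more than [2 * r] already makes the exponent q at least 4, and exp q >= 1
    + q >= 5. *)
Lemma gaussian_bump_far p r x k : 0 < r -> 2 * r < `|x 0 k - p 0 k| ->
  gaussian_bump p r x <= r / 4.
Proof.
move=> r0 far; rewrite /gaussian_bump ler_pM2l//.
rewrite expRN lef_pV2 ?posrE ?expR_gt0//; apply: le_trans (expR_ge1Dx _).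
have : 4 <= ((x 0 k - p 0 k) / r) ^+ 2.
  rewrite -real_normK ?num_real// normrM normfV (gtr0_norm r0).
  have : 2 <= `|x 0 k - p 0 k| / r by rewrite ler_pdivlMr// ltW.
  by move: (_ / r) => z; nra.
rewrite (bigD1 k)//=; set s := \sum_(_ | _) _.
have : 0 <= s by rewrite sumr_ge0// => j _; exact: sqr_ge0.
lra.
Qed.

End gaussian_bump.

(** * The test function and the lower bound for a fixed number of points *)

Section lower_bound.
Context {R : realType} {d N : nat} (hd : (0 < d)%N) (hN : (0 < N)%N).
Variables (p : 'I_N -> 'rV[R]_d) (r : R).
Hypotheses (r_gt0 : 0 < r) (r_le : 2 * r <= 1).

Definition soft_hat : 'rV[R]_d -> R :=
  smooth_max (r / (8 * N%:R)) (fun i => gaussian_bump (p i) r).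

Let N_gt0 : 0 < N%:R :> R. Proof. by rewrite ltr0n. Qed.

Let eps_gt0 : 0 < r / (8 * N%:R). Proof. by rewrite divr_gt0// mulr_gt0. Qed.

Lemma soft_hat_le_max m x : (forall i, gaussian_bump (p i) r x <= m) ->
  soft_hat x <= m + r / 8.
Proof.
move=> pm; apply: (le_trans (smooth_max_le eps_gt0 hN pm)); rewrite lerD2l.
(* The excess of the smooth maximum is eps ln N <= eps N = r / 8. *)
have lnN : ln (N%:R : R) <= N%:R by rewrite ltW// ln_sublinear.
rewrite (le_trans (ler_wpM2l (ltW eps_gt0) lnN))//.
by rewrite le_eqVlt; apply/orP; left; apply/eqP; field; rewrite gt_eqF.
Qed.

Lemma soft_hat_le x : soft_hat x <= r + r / 8.
Proof. by apply: soft_hat_le_max => i; apply: gaussian_bump_le; exact: ltW. Qed.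

Lemma soft_hat_gt0 x : 0 < soft_hat x.
Proof.
exact: lt_le_trans (gaussian_bump_gt0 _ _ r_gt0) (smooth_max_ge _ _ (Ordinal hN) eps_gt0).
Qed.

Lemma soft_hat_center i : r <= soft_hat (p i).
Proof.
by rewrite -[leLHS](gaussian_bump_center (p i) r); exact: smooth_max_ge.
Qed.

(** Cubes rather than Euclidean balls: their volume comes from the box formula, and leaving one
    forces a single coordinate far away, as [gaussian_bump_far] asks. *)
Definition cube i := [set x : 'rV[R]_d |
  forall j, x 0 j \in `[p i 0 j - 2 * r, p i 0 j + 2 * r]].

Lemma measurable_cube i : measurable (cube i).
Proof.
exact: (measurable_box_rV (fun j => `[p i 0 j - 2 * r, p i 0 j + 2 * r])).
Qed.

Lemma lebesgue_cube i : lebesgue_rV d (cube i) = ((4 * r) ^+ d)%:E.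
Proof.
pose a := \row_j (p i 0 j - 2 * r); pose b := \row_j (p i 0 j + 2 * r).
have -> : cube i = [set x | forall j, x 0 j \in `[a 0 j, b 0 j]].
  by apply/seteqP; split=> x /= + j => /(_ j); rewrite !mxE.
have ab j : a 0 j <= b 0 j by rewrite !mxE lerD2l ge0_cp // mulr_ge0 // ltW.
rewrite [LHS](lebesgue_rV_box ab); congr EFin.
rewrite (eq_bigr (fun=> 4 * r)) => [|j _]; last by rewrite !mxE; ring.
by rewrite prodr_const card_ord.
Qed.

Lemma soft_hat_far x : (forall i, ~ cube i x) ->
  soft_hat x <= r / 4 + r / 8.
Proof.
move=> nx; apply: soft_hat_le_max => i.
have /existsNP[j] := nx i.
move=> /negP; rewrite in_itv/= -ler_distlC -ltNge => xj.
by apply: (gaussian_bump_far (k := j)) => //; rewrite distrC.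
Qed.

Lemma continuous_soft_hat : continuous soft_hat.
Proof.
by apply: continuous_smooth_max => // i; exact: continuous_gaussian_bump.
Qed.

Lemma measurable_soft_hat : measurable_fun setT soft_hat.
Proof. exact: continuous_measurable_rV continuous_soft_hat. Qed.

(** The gradient averages bump gradients whose entries are at most 1 in absolute value, so the bound
    depends neither on [N] nor on [r]. *)
Lemma W1oo_norm_soft_hat_le : (W1oo_norm soft_hat <= d%:R%:E)%E.
Proof.
have d1 : 1 <= d%:R :> R by rewrite ler1n.
pose eps := r / (8 * N%:R).
pose g x : 'rV[R]_d := \row_k smooth_max_derivative eps
  (fun i => gaussian_bump (p i) r) (fun i => gaussian_bump_partial (p i) r k) x.
have := @W1oo_norm_le R d soft_hat g (r + r / 8) continuous_soft_hat.
(* [2 * r <= 1] puts the sup bound 9r/8 below 1 <= d, so that the gradient bound dominates. *)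
rewrite max_r; last by move: r_gt0 r_le d1; lra.
apply.
- by move=> x; rewrite gtr0_norm ?soft_hat_gt0// soft_hat_le.
- move=> k; rewrite (_ : (fun x => _) = smooth_max_derivative eps
    (fun i => gaussian_bump (p i) r) (fun i => gaussian_bump_partial (p i) r k)).
    apply: continuous_smooth_max_derivative => // i.
      exact: continuous_gaussian_bump.
    exact: continuous_gaussian_bump_partial.
  by apply/funext => x; rewrite mxE.
- move=> k x; rewrite mxE; apply: smooth_max_derivative_le => // i.
  exact: gaussian_bump_partial_le.
- move=> k x; rewrite mxE; apply: is_derive_smooth_max => // i.
  by apply: is_derive_gaussian_bump; rewrite gt_eqF.
Qed.

Lemma W1oo_norm_soft_hat_gt0 : (0 < W1oo_norm soft_hat)%E.
Proof.
rewrite /W1oo_norm lt_max Loo_norm_gt0//; last exact: soft_hat_gt0.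
exact: continuous_soft_hat.
Qed.

(** The empirical measure gives mass 1 to the set [E] where the function is at least [r], since
    every [p i] lies in [E]. *)
Lemma integral_empirical_soft_hat :
  (r%:E <= \int[empirical_measure p]_x (soft_hat x)%:E)%E.
Proof.
pose E := soft_hat @^-1` `[r, +oo[.
have mE : measurable E.
  by rewrite /E -[X in measurable X]setTI; exact: measurable_soft_hat.
have mf : measurable_fun setT (EFin \o soft_hat).
  by apply/measurable_EFinP; exact: measurable_soft_hat.
have E1 : empirical_measure p E = (1 : R)%:E.
  transitivity ((N%:R^-1 : R)%:E * \sum_(i < N) (\d_(p i) E : \bar R))%E => //.
  rewrite (eq_bigr (fun=> 1%E)) => [|i _].
    rewrite sumEFin sumr_const card_ord -EFinM -[_ *+ _]/(N%:R) mulVf//.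
    by rewrite gt_eqF.
  by rewrite diracE mem_set// /E /= in_itv/= andbT soft_hat_center.
apply: (@le_trans _ _ (\int[empirical_measure p]_(x in E) (cst r%:E) x)%E).
  by rewrite integral_cst// [X in (_ * X)%E](_ : _ = 1%:E) ?mule1//; exact: E1.
apply: (@le_trans _ _ (\int[empirical_measure p]_(x in E) (soft_hat x)%:E)%E).
  apply: ge0_le_integral => //.
  - by move=> x _; rewrite lee_fin ltW.
  - exact: measurable_funTS mf.
  - by move=> x; rewrite /E /= in_itv/= andbT lee_fin.
apply: ge0_subset_integral => //.
by move=> x _; rewrite lee_fin ltW// soft_hat_gt0.
Qed.

Lemma integral_soft_hat_le (m : probability 'rV[R]_d R) (M : R) :
  (forall A, measurable A -> m A <= M%:E * lebesgue_rV d A)%E ->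
  N%:R * M * (4 * r) ^+ d <= 4^-1 ->
  (\int[m]_x (soft_hat x)%:E <= (9 / 16 * r)%:E)%E.
Proof.
(* Off the cubes the function is at most 3r/8, and everywhere at most 9r/8 = 3r/8 + 3r/4; hence the
   weight 3r/4 on each cube. With total cube mass at most 1/4, the integral is at most 3r/8 + 3r/16
   = 9r/16. *)
move=> mM small; pose b i (x : 'rV[R]_d) := ((3 / 4 * r)%:E * (\1_(cube i) x)%:E)%E.
have b0 i x : (0 <= b i x)%E.
  by rewrite mule_ge0// lee_fin// mulr_ge0// ltW.
have mI i : measurable_fun setT (fun x => (\1_(cube i) x : R)%:E).
  by apply/measurable_EFinP; apply: measurable_indic; exact: measurable_cube.
have mb i : measurable_fun setT (b i).
  by apply: emeasurable_funM => //; exact: mI.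
have mf : measurable_fun setT (EFin \o soft_hat).
  by apply/measurable_EFinP; exact: measurable_soft_hat.
have fb x : ((soft_hat x)%:E <= (3 / 8 * r)%:E + \sum_(i < N) b i x)%E.
  have [[i xi]|xN] := pselect (exists i, cube i x).
    rewrite (bigD1 i)//= addeA -[leLHS]adde0 leeD//; last exact: sume_ge0.
    rewrite /b indicE mem_set// -EFinM mulr1 -EFinD lee_fin.
    by move: r_gt0 (soft_hat_le x); lra.
  rewrite -[leLHS]adde0 leeD//; last exact: sume_ge0.
  rewrite lee_fin; have : soft_hat x <= r / 4 + r / 8; last by move: r_gt0; lra.
  by apply: soft_hat_far => i xi; apply: xN; exists i.
apply: (@le_trans _ _ (\int[m]_x ((3 / 8 * r)%:E + \sum_(i < N) b i x))%E).
  apply: ge0_le_integral => //.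
  - by move=> x _; rewrite lee_fin ltW// soft_hat_gt0.
  - by apply: emeasurable_funD => //; exact: emeasurable_sum.
rewrite ge0_integralD//; last 3 first.
- by move=> x _; rewrite lee_fin mulr_ge0// ltW.
- by move=> x _; exact: sume_ge0.
- exact: emeasurable_sum.
rewrite integral_cst// [X in (_ * X + _)%E](_ : _ = 1%:E); last first.
  exact: probability_setT.
rewrite mule1 ge0_integral_sum//.
apply: (@le_trans _ _ ((3 / 8 * r)%:E + \sum_(i < N) (3 / 4 * r * (M * (4 * r) ^+ d))%:E)%E).
  rewrite leeD2l//; apply: lee_sum => i _; rewrite /b ge0_integralZl_EFin//; last first.
    by rewrite mulr_ge0// ltW.
  rewrite integral_indic//; last exact: measurable_cube.
  rewrite setIT [leRHS]EFinM lee_pmul2l// ?lte_fin ?mulr_gt0//.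
  by rewrite (le_trans (mM _ (measurable_cube i)))// lebesgue_cube.
rewrite sumEFin sumr_const card_ord -EFinD lee_fin -mulr_natl.
move: small; set q := (4 * r) ^+ d => small.
by move: (ler_wpM2l (ltW r_gt0) small) r_gt0; lra.
Qed.

Lemma BL_norm_empirical_ge (m : probability 'rV[R]_d R) (M : R) :
  (forall A, measurable A -> m A <= M%:E * lebesgue_rV d A)%E ->
  N%:R * M * (4 * r) ^+ d <= 4^-1 ->
  ((r / (4 * d%:R))%:E <= BL_norm (cadd
     (charge_of_finite_measure (empirical_measure p))
     (copp (charge_of_finite_measure m))))%E.
Proof.
move=> mM small.
have d0 : 0 < d%:R :> R by rewrite ltr0n.
have W0 := W1oo_norm_soft_hat_gt0; have Wd := W1oo_norm_soft_hat_le.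
have Wfin : W1oo_norm soft_hat \is a fin_num.
  by rewrite ge0_fin_numE ?(ltW W0)// (le_lt_trans Wd)// ltry.
have fW0 : 0 < fine (W1oo_norm soft_hat) by rewrite fine_gt0// W0 ltey_eq Wfin.
have fWd : fine (W1oo_norm soft_hat) <= d%:R by rewrite -lee_fin fineK.
apply: le_trans; last first.
  apply: ereal_sup_ubound; exists soft_hat => //; split.
    by split; [exact: continuous_soft_hat|rewrite ltey_eq Wfin].
  move=> f0; have := soft_hat_gt0 0; by rewrite f0 ltxx.
have f0 x : 0 <= soft_hat x by rewrite ltW// soft_hat_gt0.
rewrite (charge_integral_sub _ _ measurable_soft_hat f0 soft_hat_le).
have fnorm x : `|soft_hat x| <= r + r / 8 by rewrite ger0_norm// soft_hat_le.
set a := integral (empirical_measure p) _ _; set b := integral _ _ _.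
have ra : (r%:E <= a)%E by exact: integral_empirical_soft_hat.
have br : (b <= (9 / 16 * r)%:E)%E by exact: integral_soft_hat_le mM small.
have fa : a \is a fin_num.
  exact: finite_measure_integral_fin_num measurable_soft_hat fnorm.
have fb : b \is a fin_num.
  exact: finite_measure_integral_fin_num measurable_soft_hat fnorm.
clearbody a b; case: a ra fa => // a; case: b br fb => // b.
rewrite !lee_fin => br _ ra _.
(* The gap a - b is at least r - 9r/16 = 7r/16, above r/4, and the Sobolev norm is at most d. *)
rewrite invfM mulrA ler_pM//.
- by rewrite mulr_ge0// ltW.
- by move: ra br r_gt0; lra.
- by rewrite lef_pV2 ?posrE.
Qed.

End lower_bound.

(** * Choice of the scale as a function of the number of points *)

Theorem proposition5p1 (R : realType) (d : nat) (hd : (0 < d)%N)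
    (mu : nat -> probability 'rV[R]_d R) (M : R)
    (mu_ac : forall N : nat, (0 < N)%N -> mu N `<< lebesgue_rV d)
    (mu_dens : forall N : nat, (0 < N)%N ->
      (Lnorm (lebesgue_rV d) +oo
        ('d (charge_of_finite_measure (mu N)) '/d (lebesgue_rV d)) <= M%:E)%E)
    (x : forall N : nat, 'I_N -> 'rV[R]_d) :
  exists2 k : R, 0 < k & forall N : nat, (0 < N)%N ->
    ((k / N%:R `^ d%:R^-1)%:E <=
     BL_norm (cadd (charge_of_finite_measure (empirical_measure (x N)))
                   (copp (charge_of_finite_measure (mu N)))))%E.
Proof.
(* [C >= 1] gives c <= 1/16, hence [2 * r <= 1]; the factor 16 yields 4 c C = 1/4, the cube mass
   allowed below. *)
pose C := Num.max M 1; pose c := (16 * C)^-1.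
have MC : M <= C by rewrite le_max lexx.
have C1 : 1 <= C by rewrite le_max lexx orbT.
have C0 : 0 < C by rewrite (lt_le_trans ltr01).
have d0 : 0 < d%:R :> R by rewrite ltr0n.
have c0 : 0 < c by rewrite invr_gt0 mulr_gt0.
have cC : 16 * c * C = 1 by rewrite /c; field; rewrite gt_eqF.
exists (c / (4 * d%:R)) => [|N N0]; first by rewrite divr_gt0// mulr_gt0.
have NR0 : 0 < N%:R :> R by rewrite ltr0n.
pose s := N%:R `^ d%:R^-1 : R; pose r := c / s.
have s1 : 1 <= s.
  rewrite -[leLHS](powRr0 (N%:R : R)) ler_powR ?invr_ge0 ?(ltW d0)//.
  by rewrite ler1n.
have s0 : 0 < s by rewrite (lt_le_trans ltr01).
have sd : s ^+ d = N%:R.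
  by rewrite -powR_mulrn ?(ltW s0)// -powRrM mulVf ?gt_eqF// powRr1// ltW.
have r0 : 0 < r by rewrite divr_gt0.
have rc : r <= c by rewrite ler_pdivrMr// ler_peMr// ltW.
have c16 : 16 * c <= 1 by rewrite -[leRHS]cC ler_peMr// mulr_ge0// ltW.
have r1 : 2 * r <= 1 by move: rc c16 r0; lra.
have mM A : measurable A -> (mu N A <= C%:E * lebesgue_rV d A)%E.
  move=> mA; apply: measure_le_density => //.
  - exact: mu_ac.
  - exact: lebesgue_rV_setT_gt0.
  - by rewrite (le_trans (mu_dens _ N0))// lee_fin.
have small : N%:R * C * (4 * r) ^+ d <= 4^-1.
  have -> : N%:R * C * (4 * r) ^+ d = C * (4 * c) ^+ d.
    by rewrite /r mulrA expr_div_n sd; field; rewrite gt_eqF.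
  (* Since 4c <= 1 and d >= 1, the power is at most its base, so [c] can be chosen independently of
     [d]. *)
  have c4 : (4 * c) ^+ d <= 4 * c.
    rewrite -[leRHS]expr1 ler_wiXn2l//; first by rewrite mulr_ge0// ltW.
    by move: c16; lra.
  rewrite (le_trans (ler_wpM2l (ltW C0) c4))//.
  by move: cC; lra.
rewrite (_ : c / _ / _ = r / (4 * d%:R)); last first.
  by rewrite /r mulrAC.
exact: BL_norm_empirical_ge mM small.
Qed.
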